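(* Let $n\ge3$ and let $H=\langle a_1,\ldots,a_n\rangle$ be a numerical semigroup minimally generated by $a_1,\ldots,a_n$, and assume that $$\mathrm{PF}(H)=\{h+\alpha,h+2\alpha,\ldots,h+(n-1)\alpha\}$$ for integers $h\ge0$ and $\alpha>0$. For $1\le i\le n$ put $m_i=\min\{\ell>0 : \ell a_i+\alpha\in H\}$ and $M_i=m_i-1$. Then for every $1\le i\le n$, $$M_i=\max\{q_i : (q_1,\ldots,q_n)\in\mathsf Z(h)\}.$$
   Context: $\mathbb N=\{0,1,2,\ldots\}$. A numerical semigroup is a submonoid $H$ of $\mathbb N$ (containing $0$) with finite complement in $\mathbb N$; $\langle a_1,\ldots,a_n\rangle$ is the set of all $\mathbb N$-linear combinations of $a_1,\ldots,a_n$. The set of pseudo-Frobenius numbers is $\mathrm{PF}(H)=\{f\in\mathbb Z\setminus H : f+s\in H \text{ for every } 0<s\in H\}$. In the definition of $m_i$, $\ell$ ranges over positive integers. The set of factorizations of $h$ is $\mathsf Z(h)=\{(q_1,\ldots,q_n)\in\mathbb N^n : h=\sum_{i=1}^nq_ia_i\}$. *)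

(* Defs.v *)
From mathcomp Require Import all_boot all_order all_algebra.
From mathcomp Require Import mathcomp_extra boolp classical_sets functions cardinality.

Set Implicit Arguments.
Unset Strict Implicit.
Unset Printing Implicit Defensive.

Local Open Scope classical_set_scope.

Definition numerical_semigroup (H : set nat) : Prop :=
  [/\ H 0,
      forall x y, H x -> H y -> H (x + y) &
      finite_set (~` H)].

Definition generated_by n (a : 'I_n -> nat) (J : {set 'I_n}) : set nat :=
  [set x | exists q : 'I_n -> nat, x = \sum_(i in J) q i * a i].

(* Minimality is that of the indexed family, so it also rules out repetitions
   among the generators. *)
Definition minimally_generated n (H : set nat) (a : 'I_n -> nat) : Prop :=
  generated_by a finset.setT = H /\
  forall J : {set 'I_n}, J \proper finset.setT -> generated_by a J <> H.

Definition factorizations n (a : 'I_n -> nat) (h : nat) : set ('I_n -> nat) :=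
  [set q | h = \sum_(i < n) q i * a i].

(* [Posz @` H] is H seen inside the integers; a pseudo-Frobenius number may be
   negative (PF(N) = {-1}). *)
Definition pseudo_Frobenius (H : set nat) : set int :=
  [set f | ~ (Posz @` H) f /\
           forall s : nat, 0 < s -> H s -> (Posz @` H) (f + s%:Z)%R].

Definition is_min (S : set nat) (m : nat) : Prop := S m /\ lbound S m.

Definition is_max (S : set nat) (m : nat) : Prop := S m /\ ubound S m.

(* Main.v *)
(** Every [x] outside [H] lies below some pseudo-Frobenius number [f], in the
    sense that [f - x] is in [H]. For [x = M_i a_i + alpha] this gives
    [h + (k - 1) alpha - M_i a_i] in [H] for some [1 <= k <= n - 1], and [k >= 2]
    is impossible because then [h + (k - 1) alpha] would be both in [H] and
    pseudo-Frobenius; so [h - M_i a_i] is in [H]. Conversely a factorization of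
    [h] using [a_i] at least [m_i] times would put
    [h + alpha = (h - m_i a_i) + (m_i a_i + alpha)] in [H]. *)
Require Import Defs.
From mathcomp Require Import all_boot all_order all_algebra.
From mathcomp Require Import mathcomp_extra boolp classical_sets functions cardinality.

Local Open Scope classical_set_scope.

Lemma numerical_semigroup_cofinal (H : set nat) :
  numerical_semigroup H -> exists N, forall x, N <= x -> H x.
Proof.
case=> _ _ /finite_seqP[s gapsE]; exists (\max_(x <- s) x).+1 => x ltNx.
apply: contrapT => nHx.
have xs : x \in s by have : (~` H) x by []; rewrite gapsE.
have : x <= \max_(y <- s) y by apply: (leq_bigmax_seq x).
by rewrite leqNgt ltNx.
Qed.

Lemma pseudo_FrobeniusP (H : set nat) (f : nat) :
  pseudo_Frobenius H f%:Z%R <->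
  ~ H f /\ (forall s, 0 < s -> H s -> H (f + s)).
Proof.
have PoszE x : (Posz @` H) x%:Z%R <-> H x.
  by split=> [[y Hy [<-]]//|Hx]; exists x.
split=> -[nHf fH]; split.
- by move/PoszE.
- by move=> s s_gt0 Hs; apply/PoszE; rewrite PoszD; apply: fH.
- by move/PoszE.
- by move=> s s_gt0 Hs; rewrite -PoszD; apply/PoszE/fH.
Qed.

(** Take [s] largest among the elements of [H] with [x + s] outside [H]: [s = 0] is a candidate and
    cofiniteness bounds them all. For [t > 0] in [H], [x + s + t] must lie in [H], since otherwise
    [s + t] would be a larger candidate. *)
Lemma gap_below_pseudo_Frobenius (H : set nat) (x : nat) :
  numerical_semigroup H -> ~ H x ->
  exists s, H s /\ pseudo_Frobenius H (x + s)%:Z%R.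
Proof.
move=> HH nHx; have [N HN] := numerical_semigroup_cofinal _ HH.
have [H0 HD _] := HH.
pose P s := `[< H s /\ ~ H (x + s) >].
have exP : exists s, P s by exists 0; apply/asboolP; rewrite addn0.
have bP s : P s -> s <= N.
  move=> /asboolP[_ nHxs]; rewrite leqNgt; apply/negP => /ltnW leNs.
  by apply: nHxs; apply: HN; rewrite (leq_trans leNs)// leq_addl.
case: (ex_maxnP exP bP) => s /asboolP[Hs nHxs] smax.
exists s; split=> //; apply/pseudo_FrobeniusP; split=> // t t_gt0 Ht.
apply: contrapT => nH; suff /smax : P (s + t) by rewrite leqNgt -addn1 leq_add2l t_gt0.
by apply/asboolP; rewrite addnA; split=> //; apply: HD.
Qed.

Section Generators.
Context {n : nat} {H : set nat} {a : 'I_n -> nat}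
  (H_gen : minimally_generated H a).

Lemma generatedP (x : nat) : H x <-> exists q : 'I_n -> nat, x = \sum_i q i * a i.
Proof.
have [<- _] := H_gen; split=> -[q ->]; exists q.
  by apply: eq_bigl => i; rewrite finset.inE.
by apply: eq_bigl => i; rewrite finset.inE.
Qed.

Lemma generator_in (l : nat) (i : 'I_n) : H (l * a i).
Proof.
apply/generatedP; exists (fun j => if j == i then l else 0).
rewrite (bigD1 i)//= eqxx big1 ?addn0// => j /negPf ->.
by rewrite mul0n.
Qed.

(** A zero generator could be dropped without changing the generated set, against minimality. *)
Lemma generator_gt0 (i : 'I_n) : 0 < a i.
Proof.
rewrite lt0n; apply/eqP => ai0; have [genH minH] := H_gen.
apply: (minH (finset.setC (finset.set1 i))).
  rewrite finset.properT; apply/eqP => /finset.setP/(_ i).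
  by rewrite !finset.inE eqxx.
rewrite -genH; apply/seteqP; split=> x [q ->].
  exists (fun j => if j == i then 0 else q j).
  rewrite [RHS](bigD1 i) ?finset.inE//= eqxx mul0n add0n.
  apply: eq_big => j; first by rewrite !finset.inE.
  by rewrite !finset.inE => /negPf ->.
exists q; rewrite (bigD1 i) ?finset.inE//= ai0 muln0 add0n.
by apply: eq_bigl => j; rewrite !finset.inE.
Qed.

(** Remove [l] copies of [a i] from a factorization of [h], or add them to one of [s]. This turns
    bounds on the [i]-th coefficient into membership in [H]. *)
Lemma factorization_geP (h l : nat) (i : 'I_n) :
  (exists2 q, factorizations a h q & l <= q i) <->
  exists2 s, H s & h = l * a i + s.
Proof.
split=> [[q hq leq]|[s /generatedP[q ->] ->]].
  exists (\sum_j (if j == i then q j - l else q j) * a j).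
    by apply/generatedP; eexists.
  rewrite [LHS]hq (bigD1 i)//= [in RHS](bigD1 i)//= eqxx addnA -mulnDl subnKC//.
  by congr addn; apply: eq_bigr => j /negPf ->.
exists (fun j => if j == i then l + q j else q j); last by rewrite eqxx leq_addr.
rewrite /factorizations/= (bigD1 i)//= [in RHS](bigD1 i)//= eqxx addnA -mulnDl.
by congr addn; apply: eq_bigr => j /negPf ->.
Qed.

End Generators.

Theorem proposition3p4 (n : nat) (H : set nat) (a : 'I_n -> nat)
    (h alpha : nat)
    (n_ge3 : 3 <= n)
    (H_numerical : numerical_semigroup H)
    (H_gen : minimally_generated H a)
    (alpha_gt0 : 0 < alpha)
    (PF_H : pseudo_Frobenius H =
            [set (h + k * alpha)%:Z%R | k in [set k : nat | 1 <= k <= n - 1]]) :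
  forall i : 'I_n,
    exists m : nat,
      is_min [set l : nat | 0 < l /\ H (l * a i + alpha)] m /\
      is_max [set q i | q in factorizations a h] (m - 1).
Proof.
move=> i; have [H0 HD _] := H_numerical.
have PFk k : 1 <= k <= n - 1 ->
    ~ H (h + k * alpha) /\ (forall s, 0 < s -> H s -> H (h + k * alpha + s)).
  by move=> kn; apply/pseudo_FrobeniusP; rewrite PF_H; exists k.
have n1_ge2 : 2 <= n - 1 by rewrite leq_subRL ?(ltnW (ltnW n_ge3)).
(* Otherwise adding [alpha] to the pseudo-Frobenius number [h + alpha] would put [h + 2 * alpha] in
   [H]; index 2 is in range because [n >= 3]. *)
have nHalpha : ~ H alpha.
  move=> Halpha; have [|_ /(_ _ alpha_gt0 Halpha)] := PFk 1; first exact: ltnW.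
  by rewrite -addnA -mulSnr; apply: (PFk 2 _).1.
have [N HN] := numerical_semigroup_cofinal _ H_numerical.
pose P l := `[< 0 < l /\ H (l * a i + alpha) >].
have exP : exists l, P l.
  (* As [a i] is positive, [N.+1 * a i] already exceeds [N]. *)
  exists N.+1; apply/asboolP; split=> //; apply: HN.
  apply: (leq_trans (leqnSn N)); apply: (leq_trans _ (leq_addr _ _)).
  by rewrite leq_pmulr// (generator_gt0 H_gen).
case: (ex_minnP exP) => m /asboolP[m_gt0 Hm] mmin.
exists m; split; first by split=> // l /asboolP; apply: mmin.
have ub : ubound [set q i | q in factorizations a h] (m - 1).
  move=> _ [q hq <-]; rewrite Order.NatOrder.leEnat leqNgt subn1 prednK//; apply/negP => lemq.
  have [s Hs hE] : exists2 s, H s & h = m * a i + s.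
    by apply/(factorization_geP H_gen); exists q.
  have [|+ _] := PFk 1; first exact: ltnW.
  by apply; rewrite mul1n hE addnAC; apply: HD.
split=> //.
(* [mmin] only concerns positive [l], so the case [m = 1] rests on [nHalpha]. *)
have nHM : ~ H ((m - 1) * a i + alpha).
  have [->|M_gt0] := posnP (m - 1); first by rewrite mul0n.
  move=> HM; have /mmin : P (m - 1) by apply/asboolP.
  by rewrite leqNgt subn1 prednK// leqnn.
have [s [Hs]] := gap_below_pseudo_Frobenius _ _ H_numerical nHM.
(* Writing the index as [k.+1] lets one [alpha] cancel on both sides. *)
rewrite PF_H => -[[//|k] kn [hk]].
have {}hk : h + k * alpha = (m - 1) * a i + s.
  by apply: (@addIn alpha); rewrite -addnA -mulSnr hk addnAC.
have Hk : H (h + k * alpha) by rewrite hk; apply: HD => //; apply: (generator_in H_gen).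
case: k => [|k] in kn hk Hk.
  rewrite mul0n addn0 in hk.
  have [q hq leq] : exists2 q, factorizations a h q & m - 1 <= q i.
    by apply/(factorization_geP H_gen); exists s.
  exists q => //; apply/eqP; rewrite eqn_leq leq andbT.
  by apply: ub; exists q.
(* The index found is now [k.+2], so [k.+1] is also in range and [h + k.+1 * alpha] is
   pseudo-Frobenius, against [Hk]. *)
by case: (PFk k.+1 _).1 => //; exact: ltnW.
Qed.
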